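(* Let $W_\alpha(G)=\sum_{uv\in E(G)}(d(u)d(v))^\alpha$ for connected graphs $G$ with at least three vertices, i.e. $W_\alpha=M_f$ with $f(x,y)=(xy)^\alpha$, the arguments being restricted to $x,y\ge 1$ with $\max\{x,y\}\ge 2$. Then $W_\alpha$ is escalating for every real $\alpha\ne 0$, and $W_\alpha$ is good escalating for $\alpha=1$.
   Context: $d(v)$ denotes the degree of $v$. For a symmetric $f$, $M_f(G)=\sum_{uv\in E(G)}f(d(u),d(v))$, and $M_f$ is called escalating / good escalating when $f$ is. $f$ is escalating if $f(x_1,x_2)+f(y_1,y_2)\ge f(x_2,y_1)+f(x_1,y_2)$ for all $x_1\ge y_1$, $x_2\ge y_2$, strictly whenever $x_1>y_1$ and $x_2>y_2$. An escalating $f$ is good escalating if $\frac{\partial f}{\partial x}>0$, $\frac{\partial^2 f}{\partial x^2}\ge 0$, and $f(x_1+1,x_2)+f(x_1+1,y_1-1)\ge f(x_2,y_1)+f(x_1,y_1)$ for all $x_1\ge y_1$ and $x_2\ge 1$. *)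

(* Defs.v *)
From HB Require Import structures.
From mathcomp Require Import all_boot all_order all_algebra.
From mathcomp Require Import all_classical all_reals all_analysis.

Set Implicit Arguments.
Unset Strict Implicit.
Unset Printing Implicit Defensive.

Import Order.TTheory GRing.Theory Num.Theory.
Import numFieldNormedType.Exports.

Local Open Scope classical_set_scope.
Local Open Scope ring_scope.

Record sgraph := SGraph {
  vertex :> finType;
  adj : rel vertex;
  adj_sym : symmetric adj;
  adj_irrefl : irreflexive adj
}.

Definition degree (G : sgraph) (v : G) : nat := #|[pred w | adj v w]|.

Definition connected_graph (G : sgraph) : Prop :=
  forall u v : G, connect (@adj G) u v.

Definition admissible (G : sgraph) : Prop :=
  connected_graph G /\ (3 <= #|G|)%N.

(* One orientation (u, v) of each unordered edge, chosen by the enumeration of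
   the vertices; the choice is immaterial for summing a symmetric function. *)
Definition is_edge (G : sgraph) (u v : G) : bool :=
  adj u v && (enum_rank u < enum_rank v)%N.

Section Indices.
Variable R : realType.

Definition edge_index (f : R -> R -> R) (G : sgraph) : R :=
  \sum_(u : G) \sum_(v : G | is_edge u v) f (degree u)%:R (degree v)%:R.

Definition W (alpha : R) (G : sgraph) : R :=
  \sum_(u : G) \sum_(v : G | is_edge u v)
    ((degree u)%:R * (degree v)%:R) `^ alpha.

Definition weight (alpha : R) (x y : R) : R := (x * y) `^ alpha.

Definition degree_domain : set (R * R) :=
  [set p | [/\ 1 <= p.1, 1 <= p.2 & 2 <= Num.max p.1 p.2]].

(* [D] is the set of admissible arguments of [f]: an inequality is required
   exactly when every point at which it evaluates [f] lies in [D]. *)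
Definition escalating (D : set (R * R)) (f : R -> R -> R) : Prop :=
  forall x1 x2 y1 y2 : R,
    D (x1, x2) -> D (y1, y2) -> D (x2, y1) -> D (x1, y2) ->
    (y1 <= x1 -> y2 <= x2 ->
       f x2 y1 + f x1 y2 <= f x1 x2 + f y1 y2) /\
    (y1 < x1 -> y2 < x2 ->
       f x2 y1 + f x1 y2 < f x1 x2 + f y1 y2).

(* Derivatives are total operators, so existence of the partial derivatives is
   stated separately; the first one must exist around x for the second one at x
   to be meaningful. *)
Definition good_escalating (D : set (R * R)) (f : R -> R -> R) : Prop :=
  [/\ escalating D f,
      forall x y : R, D (x, y) ->
        (\forall z \near x, derivable (f^~ y) z 1) /\ 0 < derive1 (f^~ y) x,
      forall x y : R, D (x, y) ->
        derivable (derive1 (f^~ y)) x 1 /\ 0 <= derive1n 2 (f^~ y) x &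
      forall x1 x2 y1 : R, y1 <= x1 -> 1 <= x2 ->
        D (x1 + 1, x2) -> D (x1 + 1, y1 - 1) -> D (x2, y1) -> D (x1, y1) ->
        f x2 y1 + f x1 y1 <= f (x1 + 1) x2 + f (x1 + 1) (y1 - 1)].

(* [index_of f M]: on connected graphs with at least three vertices, [M] is the
   index M_f of the symmetric function [f]. *)
Definition index_of (f : R -> R -> R) (M : sgraph -> R) : Prop :=
  (forall x y : R, f x y = f y x) /\
  (forall G : sgraph, admissible G -> M G = edge_index f G).

Definition escalating_index (f : R -> R -> R) (M : sgraph -> R) : Prop :=
  index_of f M /\ escalating degree_domain f.

Definition good_escalating_index (f : R -> R -> R) (M : sgraph -> R) : Prop :=
  index_of f M /\ good_escalating degree_domain f.

End Indices.

(* Main.v *)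
Require Import Defs.
From HB Require Import structures.
From mathcomp Require Import all_boot all_order all_algebra.
From mathcomp Require Import all_classical all_reals all_analysis.
From mathcomp Require Import ring lra.
Import Order.TTheory GRing.Theory Num.Theory.
Import numFieldNormedType.Exports.
Local Open Scope ring_scope.

(** On arguments [>= 1] the function [(x y)^alpha] is multiplicative, so the
    escalating inequality says that
    [(x1^alpha - y1^alpha) (x2^alpha - y2^alpha) >= 0]: both factors have the
    sign of [alpha].  For [alpha = 1] the partial derivative in [x] is the
    constant [y], and the last inequality reads
    [(x2 - 1) (x1 - y1) + (x2 - 1) >= 0]. *)

Lemma weight_sym (R : realType) (alpha x y : R) :
  weight alpha x y = weight alpha y x.
Proof. by rewrite /weight mulrC. Qed.

(** [W alpha] and [edge_index (weight alpha)] are convertible, so only symmetry needs an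
    argument. *)
Lemma weight_index_of (R : realType) (alpha : R) :
  index_of (weight alpha) (W alpha).
Proof. by split=> // x y; exact: weight_sym. Qed.

Lemma powR_sub_mul_gt0 (R : realType) (alpha x1 x2 y1 y2 : R) :
  alpha != 0 -> 0 < y1 -> 0 < y2 -> y1 < x1 -> y2 < x2 ->
  0 < (x1 `^ alpha - y1 `^ alpha) * (x2 `^ alpha - y2 `^ alpha).
Proof.
move=> alpha0 y1_gt0 y2_gt0 lt1 lt2.
have x1_gt0 := lt_trans y1_gt0 lt1; have x2_gt0 := lt_trans y2_gt0 lt2.
(* Positive bases rule out the special case of [powR] at zero, leaving [expR (alpha * ln x)]. *)
rewrite /powR !gt_eqF //.
have ln1 : ln y1 < ln x1 by rewrite ltr_ln.
have ln2 : ln y2 < ln x2 by rewrite ltr_ln.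
(* A negative [alpha] reverses both comparisons of exponents, making both factors negative. *)
case: (ltgtP alpha 0) alpha0 => // alpha0 _.
  by rewrite nmulr_rgt0 subr_lt0 ltr_expR ltr_nM2l.
by rewrite mulr_gt0 // subr_gt0 ltr_expR ltr_pM2l.
Qed.

Lemma weight_escalating (R : realType) (alpha : R) :
  alpha != 0 -> escalating (@degree_domain R) (weight alpha).
Proof.
move=> alpha0 x1 x2 y1 y2 [/= x1_ge1 x2_ge1 _] [/= y1_ge1 y2_ge1 _] _ _.
have weight_diff : weight alpha x1 x2 + weight alpha y1 y2
    - (weight alpha x2 y1 + weight alpha x1 y2)
  = (x1 `^ alpha - y1 `^ alpha) * (x2 `^ alpha - y2 `^ alpha).
  by rewrite /weight !powRM ?(le_trans ler01) //; ring.
have strict : y1 < x1 -> y2 < x2 ->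
    weight alpha x2 y1 + weight alpha x1 y2
    < weight alpha x1 x2 + weight alpha y1 y2.
  move=> lt1 lt2; rewrite -subr_gt0 weight_diff.
  by apply: powR_sub_mul_gt0; rewrite // (lt_le_trans ltr01).
(* If either coordinate is an equality, both sides agree by symmetry of [weight]; otherwise the
   strict case applies. *)
split=> //; rewrite [y1 <= x1]le_eqVlt [y2 <= x2]le_eqVlt.
case/predU1P=> [<-|lt1]; first by rewrite (weight_sym _ alpha x2).
case/predU1P=> [<-|lt2]; first by rewrite (weight_sym _ alpha y2) addrC.
exact/ltW/strict.
Qed.

Lemma weight1E (R : realType) (x y : R) :
  0 <= x -> 0 <= y -> weight 1 x y = x * y.
Proof. by move=> x0 y0; rewrite /weight powRr1 // mulr_ge0. Qed.

(* Only on [0 < x]: for negative [x * y], [weight 1 x y] is a junk value. *)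
Lemma is_derive_weight1 (R : realType) (x y : R) :
  0 < x -> 0 < y -> is_derive x 1 ((weight 1)^~ y) y.
Proof.
move=> x_gt0 y_gt0.
have mul_derive : is_derive x (1 : R) (fun z : R => z * y) y.
  by apply: is_derive_eq; rewrite scaler0 add0r /GRing.scale /= mulr1.
apply: near_eq_is_derive mul_derive.
near=> z; rewrite weight1E ?ltW //.
by near: z; exact: lt_nbhsr.
Unshelve. all: by end_near. Qed.

Lemma derive1_weight1 (R : realType) (x y : R) :
  0 < x -> 0 < y -> derive1 ((weight 1)^~ y) x = y.
Proof.
move=> x_gt0 y_gt0; rewrite derive1E.
by have dw := is_derive_weight1 _ _ _ x_gt0 y_gt0; rewrite derive_val.
Qed.

(** Positivity is an open condition, so the first derivative is the constant [y] on a whole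
    neighbourhood of [x], and differentiation is local. *)
Lemma is_derive_derive1_weight1 (R : realType) (x y : R) :
  0 < x -> 0 < y -> is_derive x 1 (derive1 ((weight 1)^~ y)) 0.
Proof.
move=> x_gt0 y_gt0.
apply: near_eq_is_derive (is_derive_cst y x 1).
near=> z; rewrite derive1_weight1 //.
by near: z; exact: lt_nbhsr.
Unshelve. all: by end_near. Qed.

Lemma weight1_good_escalating (R : realType) :
  good_escalating (@degree_domain R) (weight 1).
Proof.
split.
- exact/weight_escalating/oner_neq0.
- move=> x y [/= x_ge1 y_ge1 _].
  have x_gt0 := lt_le_trans ltr01 x_ge1; have y_gt0 := lt_le_trans ltr01 y_ge1.
  split; last by rewrite derive1_weight1.
  near=> z; apply: ex_derive; apply: is_derive_weight1 => //.
  by near: z; exact: lt_nbhsr.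
- move=> x y [/= x_ge1 y_ge1 _].
  have x_gt0 := lt_le_trans ltr01 x_ge1; have y_gt0 := lt_le_trans ltr01 y_ge1.
  have dd := is_derive_derive1_weight1 _ _ _ x_gt0 y_gt0.
  split; first exact: ex_derive.
  by rewrite /derive1n /= derive1E derive_val.
(* Membership of [(x1 + 1, y1 - 1)] in the domain gives [2 <= y1 <= x1], so all arguments are
   positive and every [weight 1] is a genuine product. *)
- move=> x1 x2 y1 le_y1x1 x2_ge1 _ [/= _ y1B1_ge1 _] _ _.
  rewrite !weight1E; nra.
Unshelve. all: by end_near. Qed.

Theorem theorem9 (R : realType) :
  (forall alpha : R, alpha <> 0 -> escalating_index (weight alpha) (W alpha)) /\
  good_escalating_index (weight (1 : R)) (W (1 : R)).
Proof.
split=> [alpha /eqP alpha0|]; split; try exact: weight_index_of.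
- exact: weight_escalating.
- exact: weight1_good_escalating.
Qed.
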